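(* A Sudoku grid has a unique solution if and only if it has a logically deducible solution.
   Context: A Sudoku proposition is a formal symbol $r_ic_j \not\approx d$ with $i,j,d\in\{1,\dots,9\}$. Sudoku formulas are built inductively from Sudoku propositions and the constants $\top,\bot$ using $\lnot,\land,\lor,\Rightarrow,\Leftrightarrow$. A grid is a $9\times 9$ matrix $\mathcal{A}=[A_{ij}]_{9\times 9}$ of nonempty subsets $A_{ij}\subseteq\{1,\dots,9\}$; it is full if $|A_{ij}|=1$ for all $i,j$. Satisfaction $\mathcal{A}\models\phi$: $\mathcal{A}\models\top$ always, $\mathcal{A}\models\bot$ never, $\mathcal{A}\models r_ic_j\not\approx d$ iff $d\notin A_{ij}$, and the connectives are interpreted classically. Write $r_ic_j\equiv d$ for $\bigwedge_{s\ne d} r_ic_j\not\approx s$, and $r_ic_j\parallel r_\ell c_m$ for $\bigwedge_{1\le d\le 9}((r_ic_j\equiv d\Rightarrow r_\ell c_m\not\approx d)\land(r_\ell c_m\equiv d\Rightarrow r_ic_j\not\approx d))$. The set $\Sigma_{ax}$ consists of 27 formulas, one for each row, each column and each of the nine standard $3\times 3$ boxes: the conjunction of $r_ic_j\parallel r_\ell c_m$ over all pairs of distinct cells in that row, column or box. A Sudoku grid is a grid $\mathcal{A}$ with $\mathcal{A}\models\phi$ for all $\phi\in\Sigma_{ax}$ (i.e. whenever $A_{ij}=\{d\}$, $d$ belongs to no $A_{\ell m}$ for another cell in the same row, column or box). A full Sudoku grid is a Sudoku grid that is full. A solution of a Sudoku grid $\mathcal{A}=[A_{ij}]$ is a full Sudoku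 grid $\mathcal{S}=[S_{ij}]$ with $S_{ij}\subseteq A_{ij}$ for all $i,j$. A Sudoku axiom is a Sudoku formula that holds in every full Sudoku grid; $\Delta_{ax}$ is the set of all Sudoku axioms. For a set $\Phi$ of Sudoku formulas and a Sudoku formula $\alpha$, $\Phi\vdash\alpha$ means there is a finite sequence $\phi_1,\dots,\phi_n=\alpha$ of Sudoku formulas such that each $\phi_i$ is in $\Delta_{ax}$, or in $\Phi$, or is obtained by modus ponens from earlier formulas (there are $p,q<i$ with $\phi_q$ equal to $\phi_p\Rightarrow\phi_i$). $\Phi\vdash\Psi$ means $\Phi\vdash\alpha$ for all $\alpha\in\Psi$. For a Sudoku grid $\mathcal{A}$ let $\mathrm{Prop}(\mathcal{A})=\{r_ic_j\not\approx d: 1\le i,j,d\le 9,\ d\notin A_{ij}\}$. A solution $\mathcal{S}$ of $\mathcal{A}$ is a logically deducible solution of $\mathcal{A}$ if $\mathrm{Prop}(\mathcal{A})\vdash\mathrm{Prop}(\mathcal{S})$. *)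

(* Defs.v *)
From mathcomp Require Import all_boot all_order all_algebra.

Set Implicit Arguments.
Unset Strict Implicit.
Unset Printing Implicit Defensive.

(* Row and column indices and digits 1, ..., 9 are encoded as 0, ..., 8. *)
Notation cell := ('I_9 * 'I_9)%type.

(* [Neq i j d] is the Sudoku proposition that cell (i, j) is not d. *)
Inductive formula : Type :=
| Neq of 'I_9 & 'I_9 & 'I_9
| Top
| Bot
| Not of formula
| And of formula & formula
| Or of formula & formula
| Imp of formula & formula
| Iff of formula & formula.

(* Arrays of candidate sets, possibly empty; see [is_grid]. *)
Notation array := 'M[{set 'I_9}]_9.

Definition is_grid (A : array) : Prop := forall i j, A i j != set0.

Definition full (A : array) : Prop := forall i j, #|A i j| = 1.

Fixpoint sat (A : array) (phi : formula) : bool :=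
  match phi with
  | Neq i j d => d \notin A i j
  | Top => true
  | Bot => false
  | Not f => ~~ sat A f
  | And f g => sat A f && sat A g
  | Or f g => sat A f || sat A g
  | Imp f g => sat A f ==> sat A g
  | Iff f g => sat A f == sat A g
  end.

(* A finite conjunction of formulas is nested to the right, in the order of
   the canonical enumeration of its index type, and ends with [Top]. *)

(* Under [is_grid], this holds exactly when the candidate set of [x] is {d}. *)
Definition cell_is (x : cell) (d : 'I_9) : formula :=
  \big[And/Top]_(s < 9 | s != d) Neq x.1 x.2 s.

Definition differ (x y : cell) : formula :=
  \big[And/Top]_(d < 9)
    And (Imp (cell_is x d) (Neq y.1 y.2 d))
        (Imp (cell_is y d) (Neq x.1 x.2 d)).

Definition row_cells (i : 'I_9) : {set cell} := [set x : cell | x.1 == i].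

Definition col_cells (j : 'I_9) : {set cell} := [set x : cell | x.2 == j].

Definition box_cells (a b : 'I_3) : {set cell} :=
  [set x : cell | (x.1 %/ 3 == a) && (x.2 %/ 3 == b)].

(* Each unordered pair of distinct cells occurs in both orders; [differ] is
   symmetric up to the order of its conjuncts. *)
Definition all_differ (U : {set cell}) : formula :=
  \big[And/Top]_(x in U) \big[And/Top]_(y in U | y != x) differ x y.

Definition Sigma_ax (phi : formula) : Prop :=
  [\/ exists i, phi = all_differ (row_cells i),
      exists j, phi = all_differ (col_cells j)
    | exists a b, phi = all_differ (box_cells a b)].

Definition sudoku_grid (A : array) : Prop :=
  is_grid A /\ forall phi, Sigma_ax phi -> sat A phi.

Definition full_sudoku_grid (A : array) : Prop := sudoku_grid A /\ full A.

Definition solution (A S : array) : Prop :=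
  full_sudoku_grid S /\ forall i j, S i j \subset A i j.

Definition Delta_ax (phi : formula) : Prop :=
  forall A, full_sudoku_grid A -> sat A phi.

Definition derivation (Phi : formula -> Prop) (s : seq formula) : Prop :=
  forall k, k < size s ->
    [\/ Delta_ax (nth Top s k),
        Phi (nth Top s k)
      | exists p q, [/\ p < k, q < k
                      & nth Top s q = Imp (nth Top s p) (nth Top s k)]].

Definition proves (Phi : formula -> Prop) (alpha : formula) : Prop :=
  exists s, derivation Phi (rcons s alpha).

Definition proves_all (Phi Psi : formula -> Prop) : Prop :=
  forall alpha, Psi alpha -> proves Phi alpha.

Definition props (A : array) (phi : formula) : Prop :=
  exists i j d, d \notin A i j /\ phi = Neq i j d.

Definition logically_deducible_solution (A S : array) : Prop :=
  solution A S /\ proves_all (props A) (props S).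

(* Main.v *)
(* Soundness of derivations shows that a solution whose propositions are deducible contains every other solution, hence equals it, all of them being full. Conversely, if S is the only solution and alpha is a proposition of S, the iterated implication from the finitely many propositions of A to alpha holds in every full Sudoku grid: such a grid satisfying those propositions is a solution of A, that is, S. This implication is thus a Sudoku axiom, and alpha follows by modus ponens. *)
Require Import Defs.
From mathcomp Require Import all_boot all_order all_algebra.

Lemma derivation_sound (Phi : formula -> Prop) (s : seq formula) (B : array) :
  full_sudoku_grid B -> (forall phi, Phi phi -> sat B phi) ->
  derivation Phi s -> forall k, k < size s -> sat B (nth Top s k).
Proof.
move=> hB hPhi hs k; elim/ltn_ind: k => k IH lt_ks.
have [hax | hphi | [p [q [lt_pk lt_qk eq_q]]]] := hs k lt_ks.
- exact: hax.
- exact: hPhi.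
- have := IH q lt_qk (ltn_trans lt_qk lt_ks).
  by rewrite eq_q /= (IH p lt_pk (ltn_trans lt_pk lt_ks)).
Qed.

Lemma proves_sound (Phi : formula -> Prop) (alpha : formula) (B : array) :
  full_sudoku_grid B -> (forall phi, Phi phi -> sat B phi) ->
  proves Phi alpha -> sat B alpha.
Proof.
move=> hB hPhi [s hs].
have := derivation_sound _ _ _ hB hPhi hs (size s).
by rewrite size_rcons nth_rcons ltnn eqxx; apply.
Qed.

(** Both premises of the modus ponens lie inside [s], so appending [phi] leaves their [nth]
    unchanged. *)
Lemma derivation_rcons (Phi : formula -> Prop) (s : seq formula) (phi : formula) :
  derivation Phi s ->
  [\/ Delta_ax phi, Phi phi
    | exists p q, [/\ p < size s, q < size s
                    & nth Top s q = Imp (nth Top s p) phi]] ->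
  derivation Phi (rcons s phi).
Proof.
move=> hs hphi k; rewrite size_rcons ltnS leq_eqVlt => /predU1P[-> | lt_ks].
- rewrite nth_rcons ltnn eqxx; case: hphi => [h | h | [p [q [lt_p lt_q eq_q]]]].
  + exact: Or31.
  + exact: Or32.
  + by apply: Or33; exists p, q; rewrite !nth_rcons lt_p lt_q.
- rewrite nth_rcons lt_ks.
  case: (hs k lt_ks) => [h | h | [p [q [lt_p lt_q eq_q]]]].
  + exact: Or31.
  + exact: Or32.
  + apply: Or33; exists p, q.
    by rewrite !nth_rcons (ltn_trans lt_p lt_ks) (ltn_trans lt_q lt_ks).
Qed.

Lemma proves_axiom (Phi : formula -> Prop) (phi : formula) :
  Delta_ax phi -> proves Phi phi.
Proof. by move=> h; exists [::]; apply: derivation_rcons => //; exact: Or31. Qed.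

Lemma proves_imp_hyp (Phi : formula -> Prop) (phi psi : formula) :
  proves Phi (Imp phi psi) -> Phi phi -> proves Phi psi.
Proof.
move=> [s hs] hphi; exists (rcons (rcons s (Imp phi psi)) phi).
apply: derivation_rcons; first by apply: derivation_rcons => //; exact: Or32.
(* The appended [phi] is at position [(size s).+1], right after the implication at [size s]. *)
apply: Or33; exists (size s).+1, (size s).
by rewrite !(nth_rcons, size_rcons) !ltnS !leqnn ltnn !eqxx leqnSn.
Qed.

(** Nested implications, rather than one implication from a conjunction, let each hypothesis be
    discharged by a single modus ponens. *)
Definition imp_seq {T : Type} (f : T -> formula) (ts : seq T) (alpha : formula) :=
  foldr (fun t => Imp (f t)) alpha ts.

Lemma sat_imp_seq (T : Type) (f : T -> formula) (ts : seq T) (alpha : formula)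
    (B : array) :
  sat B (imp_seq f ts alpha) = (all (fun t => sat B (f t)) ts ==> sat B alpha).
Proof. by elim: ts => //= t ts ->; case: (sat B (f t)). Qed.

Lemma proves_imp_seq (T : eqType) (Phi : formula -> Prop) (f : T -> formula)
    (ts : seq T) (alpha : formula) :
  {in ts, forall t, Phi (f t)} -> proves Phi (imp_seq f ts alpha) ->
  proves Phi alpha.
Proof.
elim: ts => //= t ts IH hts hp; apply: IH.
- by move=> u hu; apply: hts; rewrite inE hu orbT.
- by apply: proves_imp_hyp hp _; apply: hts; rewrite mem_head.
Qed.

(** Contraposition in each cell; this translates between satisfaction, used by soundness, and
    inclusion, used by [solution]. *)
Lemma sat_props (A B : array) :
  (forall phi, props A phi -> sat B phi) <-> (forall i j, B i j \subset A i j).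
Proof.
split=> [h i j | h _ [i [j [d [hd ->]]]]].
- apply/subsetP => d; apply: contraLR => hd.
  by apply: (h (Neq i j d)); exists i, j, d.
- by apply: contra hd => /(subsetP (h i j)).
Qed.

Lemma full_sub_eq (S B : array) :
  full S -> full B -> (forall i j, B i j \subset S i j) -> S = B.
Proof.
move=> hS hB h; apply/matrixP => i j; apply/esym/eqP.
by rewrite eqEcard h hS hB.
Qed.

(** The completeness half: the candidates excluded by [A] form a finite list [ts], and a full Sudoku
    grid satisfying all of [ts] is a solution of [A], so [imp_seq f ts alpha] is an axiom. *)
Lemma proves_of_all_solutions (A : array) (alpha : formula) :
  (forall B, solution A B -> sat B alpha) -> proves (props A) alpha.
Proof.
move=> h; pose f (t : 'I_9 * 'I_9 * 'I_9) := Neq t.1.1 t.1.2 t.2.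
pose ts := [seq t <- enum {: 'I_9 * 'I_9 * 'I_9} | t.2 \notin A t.1.1 t.1.2].
apply: (@proves_imp_seq _ _ f ts).
  by move=> [[i j] d]; rewrite mem_filter /= => /andP[hd _]; exists i, j, d.
apply: proves_axiom => B hB; rewrite sat_imp_seq; apply/implyP => /allP hts.
apply: h; split=> //; apply/sat_props => _ [i [j [d [hd ->]]]].
by apply: (hts (i, j, d)); rewrite mem_filter /= hd mem_enum.
Qed.

Theorem corollary5p12 (A : 'M[{set 'I_9}]_9) (hA : sudoku_grid A) :
  (exists! S, solution A S) <-> (exists S, logically_deducible_solution A S).
Proof.
split=> [[S [hS uniqS]] | [S [hS hded]]]; exists S; split=> //.
- move=> _ [i [j [d [hd ->]]]]; apply: proves_of_all_solutions => B hB.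
  by rewrite -(uniqS B hB).
- move=> B [hB hBA]; have [[_ fullS] _] := hS; have [_ fullB] := hB.
  (* [B] satisfies [props A], hence by soundness [props S], which places it inside [S]. *)
  apply: full_sub_eq => //; apply/sat_props => phi /hded.
  by apply: proves_sound hB _; apply/sat_props.
Qed.
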